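(* Let $N\ge 1$ be an integer, let $p\in(0,1)$, and let $\{S_n\}_{0\le n\le N}$ be a Bernoulli random walk with parameter $p$, with running maximum $M_n=\max\{S_0,\dots,S_n\}$. Let $f:\{0,1,\dots,N\}\to\mathbb{R}$ be nonincreasing and convex, and consider the optimal stopping problem $$\sup_{0\le\tau\le N}\mathrm{E}[f(M_N-S_\tau)],$$ where the supremum is over all stopping times $\tau\le N$ adapted to the natural filtration of $\{S_k\}_{0\le k\le N}$. (i) If $p<1/2$ and $f$ is nonconstant, then the rule $\tau\equiv 0$ is the unique optimal rule. (ii) If $p>1/2$ and $f$ is strictly decreasing, then the rule $\tau\equiv N$ is the unique optimal rule. (iii) If $p=1/2$ and $f$ is strictly convex, then the only optimal rules are those that satisfy, almost surely, $S_\tau=M_\tau$ or $\tau=N$.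
   Context: A Bernoulli random walk with parameter $p\in(0,1)$ is the process $S_0\equiv 0$, $S_n=X_1+\dots+X_n$ for $n\ge1$, where $X_1,X_2,\dots$ are i.i.d. with $\mathrm{P}(X_1=1)=p$ and $\mathrm{P}(X_1=-1)=q:=1-p$. A function $f:\{0,1,\dots,N\}\to\mathbb{R}$ is convex if $f(k)-2f(k+1)+f(k+2)\ge 0$ for all $0\le k\le N-2$, and strictly convex if this inequality is strict for all such $k$. A stopping time (rule) is optimal if it attains the supremum in the optimal stopping problem. Uniqueness of stopping times is understood up to almost sure equality. *)

(* Defs.v *)
From HB Require Import structures.
From mathcomp Require Import all_boot all_order all_algebra finmap.
From mathcomp Require Import all_classical all_reals all_analysis.

Set Implicit Arguments.
Unset Strict Implicit.
Unset Printing Implicit Defensive.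

Import Order.TTheory GRing.Theory Num.Theory.

Local Open Scope classical_set_scope.
Local Open Scope ring_scope.

Section independence.
Context {d : measure_display} {T : measurableType d} {R : realType}.
Variables (P : probability T R) (X : nat -> {RV P >-> R}).

Definition mutually_independent : Prop :=
  forall (J : {fset nat}) (A : nat -> set R),
    (forall j, measurable (A j)) ->
    P (\bigcap_(j in [set` J]) (X j @^-1` A j)) =
    (\prod_(j <- J) P (X j @^-1` A j))%E.

Definition identically_distributed : Prop :=
  forall (i j : nat) (A : set R), measurable A ->
    distribution P (X i) A = distribution P (X j) A.

(* Steps are numbered from 0: X k is the increment S_(k+1) - S_k. *)
Definition bernoulli_steps (p : R) : Prop :=
  [/\ mutually_independent, identically_distributed,
      P (X 0%N @^-1` [set 1]) = p%:E &
      P (X 0%N @^-1` [set -1]) = (1 - p)%:E].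

End independence.

Section walk.
Context {d : measure_display} {T : measurableType d} {R : realType}.
Context {P : probability T R}.
Variable X : nat -> {RV P >-> R}.

Definition walk (n : nat) (t : T) : R := \sum_(k < n) X k t.

Definition walk_max (n : nat) (t : T) : R :=
  \big[Num.max/walk 0 t]_(k < n.+1) walk k t.

Definition natural_filtration (n : nat) : set (set T) :=
  g_sigma_preimage (fun k : 'I_n.+1 => walk k).

Definition stopping_time (N : nat) (tau : T -> nat) : Prop :=
  (forall t, (tau t <= N)%N) /\
  (forall n, natural_filtration n [set t | (tau t <= n)%N]).

End walk.

Section functions_on_0_N.
Context {R : realType} {N : nat}.
Implicit Type f : 'I_N.+1 -> R.

Definition nonincreasing_fct f : Prop :=
  forall i j : 'I_N.+1, (i <= j)%N -> f j <= f i.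

Definition strictly_decreasing_fct f : Prop :=
  forall i j : 'I_N.+1, (i < j)%N -> f j < f i.

Definition constant_fct f : Prop := exists c : R, forall i, f i = c.

Definition convex_fct f : Prop := forall k : nat, (k.+2 <= N)%N ->
  0 <= f (inord k) - 2 * f (inord k.+1) + f (inord k.+2).

Definition strictly_convex_fct f : Prop := forall k : nat, (k.+2 <= N)%N ->
  0 < f (inord k) - 2 * f (inord k.+1) + f (inord k.+2).

(* For x = k%:R with k <= N this is f k. The argument M_N - S_tau below is
   almost surely of this form; the values at other x are irrelevant. *)
Definition eval_at f (x : R) : R := f (inord (Num.truncn x)).

End functions_on_0_N.

Section optimal_stopping.
Context {d : measure_display} {T : measurableType d} {R : realType}.
Context {P : probability T R}.
Variables (X : nat -> {RV P >-> R}) (N : nat) (f : 'I_N.+1 -> R).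

Definition expected_reward (tau : T -> nat) : \bar R :=
  'E_P[fun t => eval_at f (walk_max X N t - walk X (tau t) t)]%E.

Definition optimal_value : \bar R :=
  ereal_sup [set expected_reward tau | tau in stopping_time X N].

Definition optimal (tau : T -> nat) : Prop :=
  stopping_time X N tau /\ expected_reward tau = optimal_value.

Definition unique_optimal (tau0 : T -> nat) : Prop :=
  optimal tau0 /\
  forall tau, optimal tau -> {ae P, forall t, tau t = tau0 t}.

End optimal_stopping.

(* Main.v *)
Require Import Defs.
From HB Require Import structures.
From mathcomp Require Import all_boot all_order all_algebra finmap.
From mathcomp Require Import zify ring lra.
From mathcomp Require Import all_classical all_reals all_analysis.
From mathcomp Require Import measurable_realfun.

Set Implicit Arguments.
Unset Strict Implicit.
Unset Printing Implicit Defensive.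

Import Order.TTheory GRing.Theory Num.Theory.

Local Open Scope ring_scope.

(** Stop the walk at time n, write D_n = M_n - S_n for the drawdown and
    m = N - n for the remaining time.  Then M_N - S_n = max(D_n, L), where L is
    the maximum of the walk made of the remaining m steps and is independent of
    the past; so stopping is worth [stop_value p m f (D_n)], with
    [stop_value p m f x] the expectation of f(max(x, L)).  The drawdown itself
    is a Lindley walk: it moves by -1 with probability p and by +1 with
    probability 1 - p, and is kept at 0 when it would become negative.

    Let W m x be a family of functions with W >= [stop_value] and with
    W m.+1 x at least the mean of W m after one step of the drawdown.  By
    [payoff_loss], W N 0 exceeds the mean payoff of a stopping rule by the mean
    of a sum of nonnegative losses, one for each step the rule waits and one
    for the moment it stops.  If some rule loses nothing then W N 0 is the
    value of the problem, and the optimal rules are those that lose nothing on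
    any path ([payoff_maxP]).

    In all three cases W m x is [reflected r f m x], the mean of f at time m of
    a Lindley walk started from x which goes up with probability r.
    - With r = 1 - p waiting costs nothing.  If p > 1/2 stopping before N
      always costs something; if p = 1/2 it does so exactly when the drawdown
      is positive, f being strictly convex.  This settles these two regimes.
    - With r = p < 1/2 the family belongs to the walk with opposite drift.
      Waiting has a nonnegative cost because W is nonincreasing in the drawdown,
      which goes up with probability 1 - p > p.  Decomposing L with respect to
      the first step shows that L is distributed as a Lindley walk from 0 with
      up-probability p, so stopping at time 0 costs nothing.  A rule that waits
      at time 0 has a positive loss on the path of down-steps, which gives
      uniqueness.

    What has to be proved is that [stop_value p] <= [reflected r].  For
    p = 1/2 the Lindley walk is a simple symmetric walk on the integers folded
    by k <-> -1 - k, so both sides are means along the same symmetric walk;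
    pairing each displacement s with -s leaves a quantity which is nonnegative
    by convexity ([stop_gap_half]).  For p < 1/2 ([stop_gap_tilted]), on each
    path the difference of the two sides is nonnegative if the path has at
    least as many down-steps as up-steps and nonpositive in the opposite case,
    so passing from the symmetric weights to weights that favour down-steps
    preserves the sign of the mean.  For p > 1/2 one compares with p = 1/2: as
    f is nonincreasing, replacing p by 1/2 increases [stop_value p] and
    decreases [reflected (1 - p)] ([iter_transition_anti]).

    The probability space enters only through the first N steps, which take
    each of the 2 ^ N sequences of signs with positive probability and together
    with probability 1.  Events of the natural filtration at time n do not
    separate points with the same walk up to n, so a stopping time is a rule
    on sign sequences. *)

(** * Means over sign sequences *)

Section finite_walk.
Variable R : realFieldType.
Implicit Types (p r : R) (m n x : nat) (e : seq bool) (F G : seq bool -> R).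
Implicit Types phi f : nat -> R.

Fixpoint sign_seqs m : seq (seq bool) :=
  if m is m'.+1 then
    [seq true :: e | e <- sign_seqs m'] ++ [seq false :: e | e <- sign_seqs m']
  else [:: [::]].

Lemma mem_sign_seqs m e : (e \in sign_seqs m) = (size e == m).
Proof.
elim: m e => [|m IHm] [|b e] //=; rewrite mem_cat.
  by apply/negbTE; rewrite negb_or; apply/andP; split; apply/mapP => -[].
have consK (c : bool) : injective (cons c) by move=> ? ? [].
case: b; rewrite eqSS -IHm (mem_map (consK _)).
  by rewrite orbC; case: mapP => // -[].
by case: mapP => // -[].
Qed.

Lemma sign_seqs_uniq m : uniq (sign_seqs m).
Proof.
elim: m => //= m IHm.
have consK (c : bool) : injective (cons c) by move=> ? ? [].
rewrite cat_uniq !(map_inj_uniq (consK _)) IHm /= andbT.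
by apply/hasPn => _ /mapP[e _ ->]; apply/mapP => -[].
Qed.

Definition path_weight p e : R := \prod_(b <- e) (if b then p else 1 - p).

Definition path_mean p m F : R := \sum_(e <- sign_seqs m) path_weight p e * F e.

Lemma path_mean0 p F : path_mean p 0 F = F [::].
Proof. by rewrite /path_mean big_seq1 /path_weight big_nil mul1r. Qed.

Lemma path_meanS p m F : path_mean p m.+1 F =
  p * path_mean p m (fun e => F (true :: e)) +
  (1 - p) * path_mean p m (fun e => F (false :: e)).
Proof.
rewrite /path_mean /= big_cat /= !big_map !mulr_sumr.
by congr (_ + _); apply: eq_bigr => e _; rewrite /path_weight big_cons mulrA.
Qed.

Lemma eq_path_mean p m F G :
  (forall e, size e = m -> F e = G e) -> path_mean p m F = path_mean p m G.
Proof.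
move=> eFG; rewrite /path_mean big_seq [RHS]big_seq; apply: eq_bigr => e.
by rewrite mem_sign_seqs => /eqP/eFG->.
Qed.

Lemma path_meanD p m F G :
  path_mean p m (fun e => F e + G e) = path_mean p m F + path_mean p m G.
Proof.
by rewrite /path_mean -big_split; apply: eq_bigr => e _; rewrite mulrDr.
Qed.

Lemma path_meanZ p m (c : R) F :
  path_mean p m (fun e => c * F e) = c * path_mean p m F.
Proof.
by rewrite /path_mean mulr_sumr; apply: eq_bigr => e _; rewrite mulrCA.
Qed.

Lemma path_meanB p m F G :
  path_mean p m (fun e => F e - G e) = path_mean p m F - path_mean p m G.
Proof.
rewrite -[- path_mean p m G]mulN1r -path_meanZ -path_meanD.
by apply: eq_path_mean => e _; rewrite mulN1r.
Qed.

Lemma path_mean_cst p m (c : R) : path_mean p m (fun=> c) = c.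
Proof. by elim: m => [|m IHm]; rewrite ?path_mean0 // path_meanS IHm; ring. Qed.

Lemma path_weight_gt0 p e : 0 < p < 1 -> 0 < path_weight p e.
Proof. by move=> hp; apply: prodr_gt0 => -[] _; lra. Qed.

Lemma path_mean_ge0 p m F : 0 < p < 1 -> (forall e, size e = m -> 0 <= F e) ->
  0 <= path_mean p m F.
Proof.
move=> hp F0; rewrite /path_mean big_seq sumr_ge0 // => e.
rewrite mem_sign_seqs.
by move=> /eqP/F0; apply: mulr_ge0; apply/ltW/path_weight_gt0.
Qed.

Lemma path_mean_eq0 p m F : 0 < p < 1 -> (forall e, size e = m -> 0 <= F e) ->
  path_mean p m F = 0 -> forall e, size e = m -> F e = 0.
Proof.
move=> hp F0 /eqP; rewrite /path_mean big_seq psumr_eq0; last first.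
  move=> e; rewrite mem_sign_seqs => /eqP/F0.
  by apply: mulr_ge0; apply/ltW/path_weight_gt0.
move=> /allP h e he; move: (h e); rewrite mem_sign_seqs he eqxx => /(_ isT).
by rewrite mulf_eq0 gt_eqF ?path_weight_gt0//= => /eqP.
Qed.

Lemma path_mean_gt0 p m F e0 : 0 < p < 1 ->
  (forall e, size e = m -> 0 <= F e) ->
  size e0 = m -> 0 < F e0 -> 0 < path_mean p m F.
Proof.
move=> hp F0 e0m Fe0; rewrite lt_def path_mean_ge0 // andbT.
by apply/eqP => /path_mean_eq0-/(_ hp F0 _ e0m) E; rewrite E ltxx in Fe0.
Qed.

Lemma path_mean_negb m F :
  path_mean (1 / 2) m (fun e => F (map negb e)) = path_mean (1 / 2) m F.
Proof.
elim: m F => [|m IHm] F; first by rewrite !path_mean0.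
rewrite !path_meanS /= (IHm (fun e => F (false :: e))).
rewrite (IHm (fun e => F (true :: e))).
by rewrite addrC; congr (_ * _ + _ * _); lra.
Qed.

(** * Lindley walks *)

(** Transition operator of the Lindley walk that goes up with probability [p];
    the truncated predecessor keeps the walk at 0. *)
Definition transition p phi x : R := p * phi x.+1 + (1 - p) * phi x.-1.

(** The rightmost sign is applied first.  Read from the left instead,
    [lindley 0 e] is the maximum of the walk with steps [e], because the maximum
    over a path that starts with a step s is max(0, s + L), with L the maximum
    over the rest of the path. *)
Fixpoint lindley x e : nat :=
  if e is b :: e' then
    if b then (lindley x e').+1 else (lindley x e').-1
  else x.

(** The head of a sign sequence is the last step of the Lindley walk, so one
    more application of the operator to [phi] is one more sign in front. *)
Lemma iter_transition p m phi x :
  iter m (transition p) phi x = path_mean p m (fun e => phi (lindley x e)).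
Proof.
elim: m phi => [|m IHm] phi; first by rewrite path_mean0.
by rewrite iterSr IHm path_meanD !path_meanZ path_meanS.
Qed.

(** The walk from [x] is the free walk until it meets the walk from 0. *)
Lemma lindley_max x e :
  lindley x e = maxn (lindley 0 e) (x + count_mem true e - count_mem false e).
Proof. by elim: e => [|[] e /= ->]; rewrite /=; lia. Qed.

Lemma leq_lindley e : (lindley 0 e <= size e)%N.
Proof. by elim: e => //= -[] e; lia. Qed.

(** * Convex sequences *)

Definition antitone f := forall k, f k.+1 <= f k.
Definition convex_nat f := forall k, 0 <= f k - 2 * f k.+1 + f k.+2.
Definition strictly_convex_nat f := forall k, 0 < f k - 2 * f k.+1 + f k.+2.

Lemma antitone_le f x y : antitone f -> (x <= y)%N -> f y <= f x.
Proof.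
move=> hf /subnK <-; elim: (y - x)%N => // n; apply: le_trans.
by rewrite addSn.
Qed.

Lemma convex_decrements f i x y : convex_nat f -> (x <= y)%N ->
  f y - f (y + i)%N <= f x - f (x + i)%N.
Proof.
move=> hf xy; elim: i => [|i IHi]; first by rewrite !addn0 !subrr.
have : antitone (fun k => f k - f k.+1).
  by move=> k /=; have := hf k; lra.
move/antitone_le => /(_ (x + i)%N (y + i)%N); rewrite leq_add2r => /(_ xy).
by rewrite !addnS; move: IHi; lra.
Qed.

Lemma convex_spread f a i j : convex_nat f ->
  f (a + i)%N + f (a + j)%N <= f a + f (a + i + j)%N.
Proof.
move=> hf; have := convex_decrements i hf (leq_addr j a).
by rewrite addnAC; lra.
Qed.

Lemma strictly_convexW f : strictly_convex_nat f -> convex_nat f.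
Proof. by move=> hf k; apply: ltW. Qed.

Lemma strictly_convex_spread f a i j : strictly_convex_nat f ->
  f (a + i.+1)%N + f (a + j.+1)%N < f a + f (a + i.+1 + j.+1)%N.
Proof.
move=> hf; have cf := strictly_convexW hf.
have h1 := convex_spread a.+1 i j.+1 cf.
have h2 := convex_spread a 1 j cf.
have h3 := convex_decrements 1 cf (leq_addr j a.+1).
have h4 := hf a.
rewrite !addn1 !addnS !addSn ?addnS in h1 h2 h3 *.
by move: h1 h2 h3 h4; rewrite ?addn0; lra.
Qed.

Lemma transition_antitone p phi : 0 < p < 1 ->
  antitone phi -> antitone (transition p phi).
Proof.
move=> hp hphi k; rewrite /transition.
apply: lerD; rewrite ler_pM2l ?hphi //; try lra.
by apply: antitone_le => //; lia.
Qed.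

Lemma iter_transition_antitone p m phi : 0 < p < 1 ->
  antitone phi -> antitone (iter m (transition p) phi).
Proof. by move=> hp hphi; elim: m => //= m; apply: transition_antitone. Qed.

Lemma transition_le p phi psi x : 0 < p < 1 -> (forall y, phi y <= psi y) ->
  transition p phi x <= transition p psi x.
Proof. by move=> hp h; apply: lerD; rewrite ler_pM2l //; lra. Qed.

(** * Monotonicity in the up-probability *)

Lemma transition_anti p r phi x : p <= r -> antitone phi ->
  transition r phi x <= transition p phi x.
Proof.
move=> pr hphi; rewrite -subr_ge0.
have -> : transition p phi x - transition r phi x =
    (r - p) * (phi x.-1 - phi x.+1).
  by rewrite /transition; ring.
by rewrite mulr_ge0 ?subr_ge0 //; apply: antitone_le => //; lia.
Qed.

Lemma iter_transition_anti p r m phi x : 0 < p < 1 -> 0 < r < 1 -> p <= r ->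
  antitone phi -> iter m (transition r) phi x <= iter m (transition p) phi x.
Proof.
move=> hp hr pr hphi; elim: m x => //= m IHm x.
apply: le_trans (transition_le _ hr IHm) _.
by apply: transition_anti => //; apply: iter_transition_antitone.
Qed.

Lemma iter_transition_decreasing p m phi : 0 < p < 1 ->
  (forall k, phi k.+1 < phi k) ->
  forall k, iter m (transition p) phi k.+1 < iter m (transition p) phi k.
Proof.
move=> hp hphi; elim: m => //= m IHm k; rewrite /transition /=.
apply: ltr_leD; first by rewrite ltr_pM2l ?IHm //; lra.
rewrite ler_pM2l; last by lra.
apply: (@antitone_le (iter m (transition p) phi)); last by lia.
by move=> j; exact: ltW.
Qed.

Lemma iter_transition_lt p r m phi x :
  0 < p < 1 -> 0 < r < 1 -> p < r -> (0 < m)%N ->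
  (forall k, phi k.+1 < phi k) ->
  iter m (transition r) phi x < iter m (transition p) phi x.
Proof.
case: m => // m hp hr pr _ hphi /=.
have nphi : antitone phi by move=> k; exact: ltW.
have le_iter y := iter_transition_anti m y hp hr (ltW pr) nphi.
apply: le_lt_trans (transition_le _ hr le_iter) _.
rewrite -subr_gt0.
have -> (g : nat -> R) : transition p g x - transition r g x =
    (r - p) * (g x.-1 - g x.+1).
  by rewrite /transition; ring.
rewrite mulr_gt0 ?subr_gt0 //.
have dm := iter_transition_decreasing m hp hphi.
apply: lt_le_trans (dm x) _.
apply: (@antitone_le (iter m (transition p) phi)); last by lia.
by move=> j; exact: ltW.
Qed.

(** * The symmetric walk: folding and pairing *)

Definition displacement e : int :=
  (count_mem true e)%:Z - (count_mem false e)%:Z.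

(** Extension to the integers that is invariant under z <-> -1 - z: the
    constructor [Negz k] stands for -1 - k. *)
Definition mirror phi (z : int) : R :=
  match z with Posz k | Negz k => phi k end.

(** The Lindley walk stays at 0 where the free walk moves from 0 to -1, the
    mirror image of 0. *)
Lemma mirror_transition phi z :
  mirror (transition (1 / 2) phi) z =
  1 / 2 * (mirror phi (z + 1) + mirror phi (z - 1)).
Proof.
have half : (1 - 1 / 2 : R) = 1 / 2 by lra.
by case: z => [[|k]|[|k]] /=;
  rewrite ?subn1 ?subn0 ?addn0 ?addn1 /transition half mulrDr //= addrC.
Qed.

Lemma path_mean_mirror m phi x :
  path_mean (1 / 2) m (fun e => phi (lindley x e)) =
  path_mean (1 / 2) m (fun e => mirror phi (x%:Z + displacement e)).
Proof.
rewrite -iter_transition; elim: m phi => [|m IHm] phi.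
  by rewrite path_mean0 addr0.
rewrite iterSr IHm path_meanS -!path_meanZ -path_meanD.
apply: eq_path_mean => e _.
rewrite mirror_transition mulrDr; have -> : (1 - 1 / 2 : R) = 1 / 2 by lra.
by congr (_ * mirror _ _ + _ * mirror _ _); rewrite /displacement /=; lia.
Qed.

Lemma displacement_negb e : displacement (map negb e) = - displacement e.
Proof.
by rewrite /displacement; elim: e => //= -[] e /=; lia.
Qed.

(** Mean payoff of stopping with drawdown [x] and [m] remaining steps, whose
    walk has maximum [lindley 0 e]. *)
Definition stop_value p m f x : R :=
  path_mean p m (fun e => f (maxn x (lindley 0 e))).

(** Folding turns f(lindley x e) and f(max(x, lindley 0 e)) into functions of
    the displacement.  This is their difference at [s] plus their difference
    at -[s]. *)
Definition symmetrised_gap f x (s : nat) : R :=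
  if (s <= x)%N then f (x + s)%N + f (x - s)%N - 2 * f x
  else f (x + s)%N + f (s - x.+1)%N - f s - f s.-1.

(** In the first case the points x - s, x, x, x + s are compared, in the second
    the points s - x - 1, s - 1, s, s + x. *)
Lemma symmetrised_gap_ge0 f x s : convex_nat f -> 0 <= symmetrised_gap f x s.
Proof.
rewrite /symmetrised_gap => hf; case: leqP => sx.
  have := convex_spread (x - s) s s hf.
  have -> : (x - s + s + s = x + s)%N by lia.
  have -> : (x - s + s = x)%N by lia.
  lra.
have := convex_spread (s - x.+1) x x.+1 hf.
have -> : (s - x.+1 + x + x.+1 = x + s)%N by lia.
have -> : (s - x.+1 + x = s.-1)%N by lia.
have -> : (s - x.+1 + x.+1 = s)%N by lia.
lra.
Qed.

Lemma symmetrised_gap_gt0 f x s :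
  strictly_convex_nat f -> (0 < x)%N -> (0 < s)%N ->
  0 < symmetrised_gap f x s.
Proof.
rewrite /symmetrised_gap => hf; case: x => // x _; case: s => // s _.
case: (leqP s.+1 x.+1) => sx.
  have := strictly_convex_spread (x.+1 - s.+1) s s hf.
  have -> : (x.+1 - s.+1 + s.+1 + s.+1 = x.+1 + s.+1)%N by lia.
  have -> : (x.+1 - s.+1 + s.+1 = x.+1)%N by lia.
  lra.
have := strictly_convex_spread (s.+1 - x.+2) x x.+1 hf.
have -> : (s.+1 - x.+2 + x.+1 + x.+2 = x.+1 + s.+1)%N by lia.
have -> : (s.+1 - x.+2 + x.+1 = s)%N by lia.
have -> : (s.+1 - x.+2 + x.+2 = s.+1)%N by lia.
rewrite /=; lra.
Qed.

Lemma stop_gap_half m f x :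
  iter m (transition (1 / 2)) f x - stop_value (1 / 2) m f x =
  1 / 2 *
  path_mean (1 / 2) m (fun e => symmetrised_gap f x `|displacement e|%N).
Proof.
rewrite /stop_value iter_transition path_mean_mirror.
rewrite (path_mean_mirror _ (fun k => f (maxn x k))).
rewrite -path_meanB.
set F := fun e => _ - _.
have -> : path_mean (1 / 2) m F =
    1 / 2 * path_mean (1 / 2) m (fun e => F e + F (map negb e)).
  by rewrite (path_meanD _ _ F) (path_mean_negb m F); lra.
congr (_ * _); apply: eq_path_mean => e _; rewrite /F displacement_negb.
move: (displacement e) => z; rewrite !add0r {F e}.
wlog : z / 0 <= z => [hw|].
  have [/hw//|z0] := leP 0 z; move: (hw (- z)); rewrite opprK abszN addrC.
  by move=> ->; rewrite // oppr_ge0 ltW.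
case: z => // s _; rewrite absz_nat /symmetrised_gap.
case: leqP => sx.
  have -> : x%:Z - s%:Z = (x - s)%N by lia.
  rewrite /= (_ : maxn x s = x); last by lia.
  case: s sx => [|s] sx /=; first by rewrite (_ : maxn x 0 = x); [ring|lia].
  by rewrite (_ : maxn x s = x); [ring|lia].
have -> : x%:Z - s%:Z = Negz (s - x.+1) by lia.
case: s sx => // s sx /=.
rewrite (_ : maxn x s.+1 = s.+1); last by lia.
by rewrite (_ : maxn x s = s); [ring|lia].
Qed.

Lemma half01 : 0 < (1 / 2 : R) < 1.
Proof. by lra. Qed.

Lemma stop_le_reflected_half m f x : convex_nat f ->
  stop_value (1 / 2) m f x <= iter m (transition (1 / 2)) f x.
Proof.
move=> hf; rewrite -subr_ge0 stop_gap_half mulr_ge0 ?divr_ge0 //.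
rewrite path_mean_ge0 ?half01 //.
by move=> e _; apply: symmetrised_gap_ge0.
Qed.

Lemma stop_lt_reflected_half m f x :
  strictly_convex_nat f -> (0 < m)%N -> (0 < x)%N ->
  stop_value (1 / 2) m f x < iter m (transition (1 / 2)) f x.
Proof.
move=> hf m0 x0; rewrite -subr_gt0 stop_gap_half mulr_gt0 ?divr_gt0 //.
apply: (@path_mean_gt0 _ _ _ (nseq m true)); rewrite ?size_nseq ?half01 //.
  by move=> e _; apply: symmetrised_gap_ge0; apply: strictly_convexW.
apply: symmetrised_gap_gt0 => //; rewrite /displacement !count_nseq /=; lia.
Qed.

(** The maximum of [m] steps is distributed as a Lindley walk from 0. *)
Lemma stop_value0 p m f : stop_value p m f 0 = iter m (transition p) f 0.
Proof.
by rewrite iter_transition; apply: eq_path_mean => e _; rewrite max0n.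
Qed.

(** * Walks with negative drift *)

Lemma path_weightE p e :
  path_weight p e = p ^+ count_mem true e * (1 - p) ^+ count_mem false e.
Proof.
elim: e => [|b e]; rewrite /path_weight ?big_nil ?mulr1 // big_cons => -> /=.
by case: b; rewrite /= ?add0n ?add1n exprS; ring.
Qed.

Lemma size_count e : size e = (count_mem true e + count_mem false e)%N.
Proof. by elim: e => //= -[] e /=; lia. Qed.

Lemma path_weight_half e : path_weight (1 / 2) e = (1 / 2) ^+ size e.
Proof.
rewrite path_weightE size_count exprD; have -> : (1 - 1 / 2 : R) = 1 / 2 by lra.
by [].
Qed.

Lemma weight_antitone p (m u v : nat) : 0 < p < 1 -> p <= 1 / 2 ->
  (u <= v)%N -> (v <= m)%N ->
  p ^+ v * (1 - p) ^+ (m - v) <= p ^+ u * (1 - p) ^+ (m - u).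
Proof.
move=> hp p2 uv vm.
have -> : v = (u + (v - u))%N by lia.
set i := (v - u)%N; have -> : (m - u = i + (m - (u + i)))%N by lia.
rewrite !exprD -mulrA ler_pM2l ?exprn_gt0 ?ler_pM2r ?exprn_gt0 //; try lra.
by apply: lerXn2r; rewrite ?nnegrE; lra.
Qed.

Definition tilted_gap f x e : R := f (lindley x e) - f (maxn x (lindley 0 e)).

(** Common value against which the weights of paths of length [m] are compared:
    the weight of a path with uphalf m up-steps.  For p <= 1/2 the paths with at
    least as many down-steps as up-steps weigh at least as much, and those with
    at most as many weigh at most as much.  Rounding up makes the comparison
    strict for the path of down-steps when p < 1/2, even for m = 1. *)
Definition pivot p m : R := p ^+ uphalf m * (1 - p) ^+ (m - uphalf m).

(** By [lindley_max] the gap compares f(max(L, x + s)) with f(max(x, L)), so its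
    sign is opposite to that of the displacement s; the difference of weights
    has the same sign as the gap. *)
Lemma weighted_gap_ge0 p f x e : 0 < p < 1 -> p <= 1 / 2 -> antitone f ->
  0 <= (path_weight p e - pivot p (size e)) * tilted_gap f x e.
Proof.
move=> hp p2 hf; rewrite /tilted_gap (lindley_max x).
set u := count_mem true e; set v := count_mem false e.
have sz : size e = (u + v)%N := size_count e.
have we : path_weight p e = p ^+ u * (1 - p) ^+ (size e - u).
  by rewrite path_weightE -/u -/v sz addKn.
have [uv|uv] := leqP u v.
  apply: mulr_ge0; rewrite subr_ge0.
    by rewrite we; apply: weight_antitone => //; rewrite sz; lia.
  by apply: antitone_le => //; lia.
apply: mulr_le0; rewrite subr_le0.
  by rewrite we; apply: weight_antitone => //; rewrite sz; lia.
by apply: antitone_le => //; lia.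
Qed.

(** Under [p] = 1/2 every path has weight 2 ^- m, hence the factor 2 ^+ m. *)
Lemma stop_gap_tilted p m f x :
  iter m (transition p) f x - stop_value p m f x =
  path_mean (1 / 2) m (fun e =>
    2 ^+ m * ((path_weight p e - pivot p (size e)) * tilted_gap f x e))
  + 2 ^+ m * pivot p m *
    (iter m (transition (1 / 2)) f x - stop_value (1 / 2) m f x).
Proof.
rewrite /stop_value !iter_transition -!path_meanB -path_meanZ -path_meanD.
rewrite /path_mean.
rewrite big_seq [RHS]big_seq; apply: eq_bigr => e.
rewrite mem_sign_seqs => /eqP em; rewrite path_weight_half em /tilted_gap.
have h : (1 / 2) ^+ m * 2 ^+ m = 1 :> R.
  by rewrite -exprMn (_ : 1 / 2 * 2 = 1) ?expr1n //; lra.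
move: (f _) (f _) (path_weight p e) (pivot p m) => a b c d.
transitivity (((1 / 2) ^+ m * 2 ^+ m) * (c * (b - a))).
  by rewrite h mul1r.
by ring.
Qed.

Lemma pivot_ge0 p m : 0 < p < 1 -> 0 <= pivot p m.
Proof. by move=> hp; rewrite mulr_ge0 // exprn_ge0; lra. Qed.

Lemma stop_le_reflected p m f x : 0 < p < 1 -> p <= 1 / 2 ->
  antitone f -> convex_nat f -> stop_value p m f x <= iter m (transition p) f x.
Proof.
move=> hp p2 nf cf; rewrite -subr_ge0 stop_gap_tilted addr_ge0 //.
  apply: path_mean_ge0 => [|e _]; first exact: half01.
  by rewrite mulr_ge0 ?exprn_ge0 ?weighted_gap_ge0.
apply: mulr_ge0; last by rewrite subr_ge0; exact: stop_le_reflected_half.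
  by apply: mulr_ge0; [exact: exprn_ge0 | exact: pivot_ge0].
Qed.

(** Strictness comes from the path of down-steps, which brings the Lindley walk
    from 1 to 0. *)
Lemma stop_lt_reflected p m f : 0 < p < 1 -> p < 1 / 2 -> (0 < m)%N ->
  antitone f -> convex_nat f -> f 1%N < f 0%N ->
  stop_value p m f 1 < iter m (transition p) f 1%N.
Proof.
move=> hp p2 m0 nf cf f01.
rewrite -subr_gt0 stop_gap_tilted ltr_pwDl //; last first.
  apply: mulr_ge0; last by rewrite subr_ge0; exact: stop_le_reflected_half.
  by apply: mulr_ge0; [exact: exprn_ge0 | exact: pivot_ge0].
apply: (@path_mean_gt0 _ _ _ (nseq m false)); rewrite ?size_nseq ?half01 //.
  by move=> e _; rewrite mulr_ge0 ?exprn_ge0 ?weighted_gap_ge0 // ltW.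
have lin0 y k : lindley y (nseq k false) = (y - k)%N.
  by elim: k => [|k /= ->] /=; lia.
have tg : 0 < tilted_gap f 1 (nseq m false) 
  by rewrite /tilted_gap !lin0 subr_gt0 (_ : 1 - m = 0)%N ?sub0n //; lia.
rewrite !mulr_gt0 ?exprn_gt0 // path_weightE !count_nseq /= !mul0n mul1n.
rewrite subr_gt0 expr0 mul1r.
have q0 : 0 < 1 - p by lra.
have -> : (1 - p) ^+ m = (1 - p) ^+ uphalf m * (1 - p) ^+ (m - uphalf m).
  by rewrite -exprD; congr (_ ^+ _); lia.
rewrite ltr_pM2r ?exprn_gt0 // ltrXn2r; lra || lia.
Qed.

(** A strict inequality between the values at 0 and 1 may be lost after one
    step, as for the indicator of 0.  The one between 0 and 2 persists: it
    forces a strict inequality between 0 and 1 or between 1 and 3. *)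
Lemma iter_transition_lt02 p m phi : 0 < p < 1 -> antitone phi ->
  phi 2%N < phi 0%N ->
  iter m (transition p) phi 2%N < iter m (transition p) phi 0%N.
Proof.
move=> hp hphi h02; elim: m => //= m.
have := iter_transition_antitone m hp hphi.
move: (iter m _ _) => g hg g02; rewrite /transition /=.
have h0 := hg 0%N; have h1 := hg 1%N; have h2 := hg 2%N.
have : 0 <= p * (g 1%N - g 3%N) by rewrite mulr_ge0 //; lra.
have : 0 <= (1 - p) * (g 0%N - g 1%N) by rewrite mulr_ge0 //; lra.
have [g01|g01] := ltP (g 1%N) (g 0%N).
  have : 0 < (1 - p) * (g 0%N - g 1%N) by rewrite mulr_gt0 //; lra.
  by lra.
have : 0 < p * (g 1%N - g 3%N) by rewrite mulr_gt0 //; lra.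
by lra.
Qed.


(** * Stopping rules on sign sequences *)

Definition drawdown e : nat :=
  foldl (fun x (b : bool) => if b then x.-1 else x.+1) 0%N e.

Lemma drawdown_rcons e b :
  drawdown (rcons e b) = if b then (drawdown e).-1 else (drawdown e).+1.
Proof. by rewrite /drawdown -cats1 foldl_cat. Qed.

Lemma leq_drawdown e : (drawdown e <= size e)%N.
Proof.
elim/last_ind: e => // e b IHe; rewrite drawdown_rcons size_rcons.
by case: b; lia.
Qed.

Definition stopping_rule N (rho : seq bool -> nat) : Prop :=
  (forall e, size e = N -> (rho e <= N)%N) /\
  (forall n e e', size e = N -> size e' = N -> take n e = take n e' ->
     (rho e <= n)%N = (rho e' <= n)%N).

Definition payoff f (rho : seq bool -> nat) e : R :=
  f (maxn (drawdown (take (rho e) e)) (lindley 0 (drop (rho e) e))).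

(** What the candidate value [W] loses by one more step when [m] steps remain
    after it; the drawdown goes up when the walk goes down. *)
Definition waiting_loss p (W : nat -> nat -> R) m x : R :=
  W m.+1 x - transition (1 - p) (W m) x.

Definition stopping_loss p f (W : nat -> nat -> R) m x : R :=
  W m x - stop_value p m f x.

Definition loss p f W N (rho : seq bool -> nat) n e : R :=
  \sum_(n <= j < rho e) waiting_loss p W (N - j.+1) (drawdown (take j e)) +
  stopping_loss p f W (N - rho e) (drawdown (take (rho e) e)).

(** Mean version of the optional stopping decomposition after the signs [s],
    by induction on the remaining time: either the rule stops at once whatever
    comes next, or it waits whatever comes next, and then it pays the waiting
    loss and the decomposition applies after the next sign. *)
Lemma payoff_loss_after p f W N rho s m : stopping_rule N rho ->
  (size s + m)%N = N -> (forall e, size e = m -> (size s <= rho (s ++ e))%N) ->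
  path_mean p m (fun e => payoff f rho (s ++ e)) +
  path_mean p m (fun e => loss p f W N rho (size s) (s ++ e)) =
  W m (drawdown s).
Proof.
move=> [rhoN na]; elim: m s => [|m IHm] s sm ge_rho.
  have szs : size s = N by lia.
  have rs : rho s = size s.
    by have := ge_rho [::] erefl; have := rhoN s szs; rewrite cats0; lia.
  rewrite !path_mean0 cats0 /payoff /loss /stopping_loss rs big_geq //.
  rewrite take_size drop_size.
  by rewrite szs subnn add0r /stop_value path_mean0 /=; ring.
pose e0 := nseq m.+1 true.
have size_s e : size e = m.+1 -> size (s ++ e) = N by rewrite size_cat; lia.
have na_s e : size e = m.+1 ->
    (rho (s ++ e) <= size s)%N = (rho (s ++ e0) <= size s)%N.
  move=> em; apply: na; rewrite ?size_s ?size_nseq //.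
  by rewrite !take_cat ltnn subnn !take0.
case: (leqP (rho (s ++ e0)) (size s)) na_s => [_|_] na_s.
  have rs e : size e = m.+1 -> rho (s ++ e) = size s.
    by move=> em; have := na_s e em; have := ge_rho e em; lia.
  rewrite (@eq_path_mean _ _ _
    (fun e => f (maxn (drawdown s) (lindley 0 e)))); last first.
    by move=> e /rs re; rewrite /payoff re take_size_cat // drop_size_cat.
  rewrite (@eq_path_mean _ _ (fun e => loss _ _ _ _ _ _ _)
    (fun e => stopping_loss p f W m.+1 (drawdown s))); last first.
    move=> e /rs re; rewrite /loss re big_geq // add0r take_size_cat //.
    by congr (stopping_loss _ _ _ _ _); lia.
  by rewrite path_mean_cst /stopping_loss /stop_value; ring.
have gt_rho e : size e = m.+1 -> (size s < rho (s ++ e))%N.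
  by move=> em; rewrite ltnNge na_s.
have {}IHm b : path_mean p m (fun e => payoff f rho (s ++ b :: e)) +
    path_mean p m (fun e => loss p f W N rho (size s).+1 (s ++ b :: e)) =
    W m (drawdown (rcons s b)).
  rewrite -IHm ?size_rcons //; last 2 first.
  - by lia.
  - by move=> e em; rewrite cat_rcons; apply: gt_rho; rewrite /= em.
  by congr (_ + _); apply: eq_path_mean => e _; rewrite cat_rcons.
have lossE b :
    path_mean p m (fun e => loss p f W N rho (size s) (s ++ b :: e)) =
    waiting_loss p W m (drawdown s) +
    path_mean p m (fun e => loss p f W N rho (size s).+1 (s ++ b :: e)).
  rewrite -[X in _ = X + _](path_mean_cst p m) -path_meanD.
  apply: eq_path_mean => e em.
  rewrite /loss big_ltn ?addrA; last by apply: gt_rho; rewrite /= em.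
  by rewrite take_size_cat // (_ : N - (size s).+1 = m)%N //; lia.
rewrite !path_meanS !lossE.
have := IHm true; have := IHm false.
rewrite !drawdown_rcons /waiting_loss /transition /=.
set a := path_mean _ _ _; set b := path_mean _ _ _.
set c := path_mean _ _ _; set d := path_mean _ _ _.
move=> <- <-.
by ring.
Qed.

Lemma payoff_loss p f W N rho : stopping_rule N rho ->
  path_mean p N (payoff f rho) + path_mean p N (loss p f W N rho 0) = W N 0%N.
Proof.
by move=> hrho; have := @payoff_loss_after p f W N rho [::] N hrho; apply.
Qed.

Lemma loss_ge0 p f W N rho e : 
  (forall m x, 0 <= waiting_loss p W m x) ->
  (forall m x, 0 <= stopping_loss p f W m x) ->
  0 <= loss p f W N rho 0 e.
Proof.
by move=> w0 s0; rewrite /loss addr_ge0 // sumr_ge0.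
Qed.

Lemma payoff_le p f W N rho : 0 < p < 1 ->
  (forall m x, 0 <= waiting_loss p W m x) ->
  (forall m x, 0 <= stopping_loss p f W m x) ->
  stopping_rule N rho -> path_mean p N (payoff f rho) <= W N 0%N.
Proof.
move=> hp w0 s0 hrho.
rewrite -(payoff_loss p f W hrho) lerDl path_mean_ge0 // => e _.
exact: loss_ge0.
Qed.

Lemma payoff_maxP p f W N rho : 0 < p < 1 ->
  (forall m x, 0 <= waiting_loss p W m x) ->
  (forall m x, 0 <= stopping_loss p f W m x) ->
  stopping_rule N rho ->
  path_mean p N (payoff f rho) = W N 0%N <->
  (forall e, size e = N -> loss p f W N rho 0 e = 0).
Proof.
move=> hp w0 s0 hrho; rewrite -(payoff_loss p f W hrho); split => [h|h].
  apply: (@path_mean_eq0 p) => //; first by move=> e eN; exact: loss_ge0.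
  by move: h; lra.
by rewrite (eq_path_mean p h) path_mean_cst addr0.
Qed.

Definition reflected p f m := iter m (transition p) f.

Lemma waiting_loss_reflected p f m x :
  waiting_loss p (reflected (1 - p) f) m x = 0.
Proof. by rewrite /waiting_loss /reflected /= subrr. Qed.

Lemma loss_reflected p f N rho e :
  loss p f (reflected (1 - p) f) N rho 0 e =
  stopping_loss p f (reflected (1 - p) f) (N - rho e)
    (drawdown (take (rho e) e)).
Proof.
rewrite /loss big1 ?add0r // => j _.
exact: waiting_loss_reflected.
Qed.

(** * The three regimes *)

Lemma stop_lt_reflected_up p m f x : 0 < p < 1 -> 1 / 2 < p -> convex_nat f ->
  (forall k, f k.+1 < f k) -> (0 < m)%N ->
  stop_value p m f x < iter m (transition (1 - p)) f x.
Proof.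
move=> hp p2 cf df m0; have nf : antitone f by move=> k; exact: ltW.
have hq : 0 < 1 - p < 1 by lra.
have q2 : 1 - p < 1 / 2 by lra.
apply: le_lt_trans (iter_transition_lt x hq half01 q2 m0 df).
apply: le_trans (stop_le_reflected_half m x cf).
rewrite /stop_value -[leLHS](iter_transition p m (fun k => f (maxn x k)) 0).
rewrite -[leRHS](iter_transition (1 / 2) m (fun k => f (maxn x k)) 0).
apply: iter_transition_anti; rewrite ?half01 //; first exact: ltW.
by move=> k; apply: antitone_le => //; lia.
Qed.

(** The only loss is at stopping, and it vanishes only when no time is left. *)
Lemma never_stop_optimal p f N : 0 < p < 1 -> 1 / 2 < p -> convex_nat f ->
  (forall k, f k.+1 < f k) -> forall rho, stopping_rule N rho ->
  path_mean p N (payoff f rho) <= reflected (1 - p) f N 0 /\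
  (path_mean p N (payoff f rho) = reflected (1 - p) f N 0 <->
   forall e, size e = N -> rho e = N).
Proof.
move=> hp p2 cf df rho hrho.
have w0 m x : 0 <= waiting_loss p (reflected (1 - p) f) m x.
  by rewrite waiting_loss_reflected.
have s1 m x : (0 < m)%N -> 0 < stopping_loss p f (reflected (1 - p) f) m x.
  by move=> m0; rewrite subr_gt0; exact: stop_lt_reflected_up.
have s00 x : stopping_loss p f (reflected (1 - p) f) 0 x = 0.
  by rewrite /stopping_loss /stop_value path_mean0 /= maxn0 subrr.
have s0 m x : 0 <= stopping_loss p f (reflected (1 - p) f) m x.
  by case: m => [|m]; rewrite ?s00 // ltW ?s1.
split; first exact: payoff_le.
rewrite payoff_maxP //; split => h e eN; have := h e eN; rewrite loss_reflected.
  move=> hl; case: hrho => rhoN _; have := rhoN e eN.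
  have [//|h0 _] := leqP N (rho e); first by lia.
  by move: hl => /eqP; rewrite gt_eqF // s1 // subn_gt0.
by move=> ->; rewrite subnn s00.
Qed.

(** The only loss is at stopping, and it vanishes exactly when no time is left
    or the drawdown is 0. *)
Lemma symmetric_optimal f N : strictly_convex_nat f ->
  forall rho, stopping_rule N rho ->
  path_mean (1 / 2) N (payoff f rho) <= reflected (1 / 2) f N 0 /\
  (path_mean (1 / 2) N (payoff f rho) = reflected (1 / 2) f N 0 <->
   forall e, size e = N -> drawdown (take (rho e) e) = 0%N \/ rho e = N).
Proof.
move=> cf rho hrho.
have half' : 1 / 2 = 1 - 1 / 2 :> R by lra.
have w0 m x : 0 <= waiting_loss (1 / 2) (reflected (1 / 2) f) m x.
  by rewrite {2}half' waiting_loss_reflected.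
have s1 m x : (0 < m)%N -> (0 < x)%N ->
    0 < stopping_loss (1 / 2) f (reflected (1 / 2) f) m x.
  by move=> m0 x0; rewrite subr_gt0; exact: stop_lt_reflected_half.
have s00 m x : m = 0%N \/ x = 0%N ->
    stopping_loss (1 / 2) f (reflected (1 / 2) f) m x = 0.
  move=> [|] ->.
    by rewrite /stopping_loss /stop_value path_mean0 /= maxn0 subrr.
  by rewrite /stopping_loss stop_value0 subrr.
have s0 m x : 0 <= stopping_loss (1 / 2) f (reflected (1 / 2) f) m x.
  case: m => [|m]; first by rewrite s00 //; left.
  by case: x => [|x]; [rewrite s00 //; right | rewrite ltW ?s1].
split; first by apply: payoff_le => //; exact: half01.
rewrite payoff_maxP //; last exact: half01.
have lE e : loss (1 / 2) f (reflected (1 / 2) f) N rho 0 e =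
    stopping_loss (1 / 2) f (reflected (1 / 2) f) (N - rho e)
      (drawdown (take (rho e) e)).
  by have := loss_reflected (1 / 2) f N rho e; rewrite -half'.
split => h e eN; have := h e eN; rewrite lE; last first.
  by move=> [d0|->]; apply: s00; [right | left; rewrite subnn].
case: hrho => rhoN _; have := rhoN e eN => rN.
have [?|h0] := leqP N (rho e); first by right; lia.
case: (posnP (drawdown (take (rho e) e))) => [->|x0]; first by left.
by move=> /eqP; rewrite gt_eqF // s1 // subn_gt0.
Qed.

(** After a first down-step the drawdown is 1, where both stopping (by
    [stop_lt_reflected]) and waiting (by [iter_transition_lt02]) cost something;
    if N = 1 the first step of waiting already does. *)
Lemma stop_at_once_optimal p f N :
  0 < p < 1 -> p < 1 / 2 -> convex_nat f -> antitone f ->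
  f 1%N < f 0%N -> (0 < N)%N -> forall rho, stopping_rule N rho ->
  path_mean p N (payoff f rho) <= reflected p f N 0 /\
  (path_mean p N (payoff f rho) = reflected p f N 0 <->
   forall e, size e = N -> rho e = 0%N).
Proof.
move=> hp p2 cf nf f01 N0 rho hrho.
have hq : 0 < 1 - p < 1 by lra.
have nr m : antitone (reflected p f m) by exact: iter_transition_antitone.
have wE m x : waiting_loss p (reflected p f) m x =
    (1 - 2 * p) * (reflected p f m x.-1 - reflected p f m x.+1).
  by rewrite /waiting_loss /reflected /= /transition; ring.
have w0 m x : 0 <= waiting_loss p (reflected p f) m x.
  rewrite wE mulr_ge0 //; first by lra.
  by rewrite subr_ge0; apply: antitone_le => //; lia.
have s0 m x : 0 <= stopping_loss p f (reflected p f) m x.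
  by rewrite subr_ge0; apply: stop_le_reflected => //; exact: ltW.
split; first exact: payoff_le.
rewrite payoff_maxP //; split => h e eN; last first.
  rewrite /loss (h e eN) big_geq // add0r take0.
  by rewrite /stopping_loss stop_value0 subrr.
have [rhoN na] := hrho.
case: (posnP (rho e)) => // re.
(* A rule that waits at time 0 on one path waits there on every path, in
   particular on the path of down-steps. *)
pose e' := nseq N false.
have eN' : size e' = N by rewrite size_nseq.
have re' : (0 < rho e')%N by rewrite ltnNge -(na 0%N e e') ?take0 // -ltnNge.
have rN' := rhoN e' eN'.
suff : 0 < loss p f (reflected p f) N rho 0 e' by rewrite h // ltxx.
rewrite {h} /loss.
have s_gt0 m : (0 < m)%N -> 0 < stopping_loss p f (reflected p f) m 1.
  by move=> m0; rewrite subr_gt0 stop_lt_reflected.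
have w_gt0 m : 0 < waiting_loss p (reflected p f) m 1.
  rewrite wE mulr_gt0 //; first by lra.
  rewrite subr_gt0 iter_transition_lt02 //.
  by have := nf 1%N; lra.
have wsum i : 0 <= \sum_(i <= j < rho e')
    waiting_loss p (reflected p f) (N - j.+1) (drawdown (take j e')).
  by rewrite sumr_ge0.
have t1 : drawdown (take 1 e') = 1%N.
  by rewrite /e'; case: (N) N0 => //= n _; rewrite take0.
have sl := s0 (N - rho e')%N (drawdown (take (rho e') e')).
have [N1|N1] := leqP N 1.
  have : 0 < waiting_loss p (reflected p f) (N - 1) (drawdown (take 0 e')).
    have -> : (N - 1 = 0)%N by lia.
    by rewrite take0 wE mulr_gt0 //= ?subr_gt0 //; lra.
  by rewrite big_ltn //; have := wsum 1%N; lra.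
have [r1|r1] := leqP (rho e') 1.
  have r1' : rho e' = 1%N by lia.
  have := wsum 0%N; have := s_gt0 (N - 1)%N.
  by rewrite subn_gt0 => /(_ N1); rewrite r1' t1; lra.
rewrite big_ltn // big_ltn // t1; have := w_gt0 (N - 2)%N.
have := w0 (N - 1)%N (drawdown (take 0 e')).
by have := wsum 2%N; lra.
Qed.

End finite_walk.

Local Open Scope classical_set_scope.
Local Open Scope ring_scope.

(** * Measurability of the reward *)

Section measurability.
Context {d : measure_display} {T : measurableType d} {R : realType}.

Lemma measurable_fun_select (tau : T -> nat) (g : nat -> T -> R) :
  (forall n, measurable [set t | tau t = n]) ->
  (forall n, measurable_fun [set: T] (g n)) ->
  measurable_fun [set: T] (fun t => g (tau t) t).
Proof.
move=> mtau mg _ B mB; rewrite setTI.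
have -> : (fun t => g (tau t) t) @^-1` B =
    \bigcup_n ([set t | tau t = n] `&` (g n @^-1` B)).
  by apply/seteqP; split => [t gB|t [n _ [/= <-]]] //; exists (tau t).
apply: bigcupT_measurable => n; apply: measurableI => //.
by rewrite -[X in measurable X]setTI; apply: mg.
Qed.

Lemma measurable_eval_at N (f : 'I_N.+1 -> R) (Z : T -> R) :
  measurable_fun [set: T] Z ->
  measurable_fun [set: T] (fun t => eval_at f (Z t)).
Proof.
move=> mZ.
apply: (@measurable_fun_select (fun t => Num.truncn (Z t))
  (fun n _ => f (inord n))) => // n.
have mt : measurable_fun [set: R] (fun x : R => (Num.truncn x)%:R : R).
  by apply: nondecreasing_measurable => // x y xy; rewrite ler_nat le_truncn.
have := measurableT_comp mt mZ.
move=> /(_ measurableT [set n%:R] (measurable_set1 _)); rewrite setTI.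
congr measurable; apply/seteqP; split => t /=; last by move=> ->.
by move=> /eqP; rewrite eqr_nat => /eqP.
Qed.

End measurability.

(** * From the probability space to sign sequences *)

Section walk_transfer.
Context {d : measure_display} {T : measurableType d} {R : realType}.
Context {P : probability T R}.
Variable X : nat -> {RV P >-> R}.

Lemma walk0 t : walk X 0 t = 0.
Proof. by rewrite /walk big_ord0. Qed.

Lemma walkS n t : walk X n.+1 t = walk X n t + X n t.
Proof. by rewrite /walk big_ord_recr. Qed.

Lemma walk_max0 t : walk_max X 0 t = 0.
Proof. by rewrite /walk_max big_ord_recl big_ord0 !walk0 maxxx. Qed.

Lemma walk_maxS n t :
  walk_max X n.+1 t = Num.max (walk_max X n t) (walk X n.+1 t).
Proof.
apply/le_anti/andP; split; rewrite /walk_max.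
  apply: bigmax_le => [|i _].
    by rewrite le_max; apply/orP; left; exact: (le_bigmax _ _ ord0).
  rewrite le_max; case: (ltnP i n.+1) => ni.
    apply/orP; left.
    exact: (le_bigmax _ (fun k : 'I_n.+1 => walk X k t) (Ordinal ni)).
  by apply/orP; right; have -> : (i = n.+1 :> nat) by have := ltn_ord i; lia.
rewrite ge_max; apply/andP; split; last first.
  exact: (le_bigmax _ (fun k : 'I_n.+2 => walk X k t) ord_max).
apply: bigmax_le => [|i _].
  exact: (le_bigmax _ (fun k : 'I_n.+2 => walk X k t) ord0).
exact: (le_bigmax _ (fun k : 'I_n.+2 => walk X k t) (widen_ord (leqnSn _) i)).
Qed.

Lemma measurable_walk n : measurable_fun [set: T] (walk X n).
Proof.
elim: n => [|n IHn].
  rewrite (_ : walk X 0 = cst 0) //.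
  by apply/funext => t; rewrite walk0.
rewrite (_ : walk X n.+1 = walk X n \+ X n); first exact: measurable_funD.
by apply/funext => t; rewrite walkS.
Qed.

Lemma measurable_walk_max n : measurable_fun [set: T] (walk_max X n).
Proof.
elim: n => [|n IHn].
  rewrite (_ : walk_max X 0 = cst 0) //.
  by apply/funext => t; rewrite walk_max0.
rewrite (_ : walk_max X n.+1 = walk_max X n \max walk X n.+1).
  by apply: measurable_maxr => //; exact: measurable_walk.
by apply/funext => t; rewrite walk_maxS.
Qed.

Lemma natural_filtration_measurable n A :
  natural_filtration X n A -> measurable A.
Proof.
rewrite /natural_filtration /g_sigma_preimage; apply: smallest_sub.
  exact: sigma_algebra_measurable.
move=> B; rewrite -bigcup_mkord_ord => -[i _ [C mC <-]].
by apply: measurable_walk.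
Qed.

(** The sets that do not separate points with the same walk up to time [n] form
    a sigma-algebra that makes this walk measurable. *)
Lemma natural_filtration_saturated n A t t' : natural_filtration X n A ->
  (forall k, (k <= n)%N -> walk X k t = walk X k t') -> A t -> A t'.
Proof.
pose same t t' := forall k, (k <= n)%N -> walk X k t = walk X k t'.
have same_sym u v : same u v -> same v u by move=> h k kn; rewrite h.
suff : natural_filtration X n `<=`
    [set A | forall t t', same t t' -> A t -> A t'].
  by move=> h hA; exact: h.
apply: smallest_sub.
  split => [//|B hB u v uv [_ nBu]|F hF u v uv [i _ Fu]].
    by split => // Bv; apply: nBu; apply: hB Bv; exact: same_sym.
  by exists i => //; apply: hF Fu.
move=> B; rewrite -bigcup_mkord_ord => -[i ltin [C mC <-]] u v uv [_ /= Cu].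
by split => //=; rewrite -uv // inordK.
Qed.

(** A step is read as up if it is 1 and as down otherwise; this is faithful on
    [proper_steps], which has probability 1. *)
Definition sign_path N t : seq bool := mkseq (fun k => X k t == 1) N.

Definition proper_steps : set T := [set t | forall k, X k t = 1 \/ X k t = -1].

Lemma size_sign_path N t : size (sign_path N t) = N.
Proof. by rewrite size_mkseq. Qed.

Lemma take_sign_pathS N t n : (n < N)%N ->
  take n.+1 (sign_path N t) = rcons (take n (sign_path N t)) (X n t == 1).
Proof.
by move=> nN; rewrite (take_nth false) ?size_sign_path // nth_mkseq.
Qed.

Lemma drop_sign_path N t n : (n < N)%N ->
  drop n (sign_path N t) = (X n t == 1) :: drop n.+1 (sign_path N t).
Proof.
by move=> nN; rewrite (drop_nth false) ?size_sign_path // nth_mkseq.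
Qed.

Lemma m1_neq1 : (-1 == 1 :> R) = false.
Proof. by apply/eqP; lra. Qed.

Lemma walk_max_drawdown N t n : proper_steps t -> (n <= N)%N ->
  walk_max X n t - walk X n t = (drawdown (take n (sign_path N t)))%:R.
Proof.
move=> pt; elim: n => [|n IHn] nN; first by rewrite walk_max0 walk0 take0 subrr.
rewrite take_sign_pathS // drawdown_rcons walk_maxS walkS.
have {IHn} := IHn (ltnW nN).
set D := drawdown _; set M := walk_max _ _ _ => IHn.
have -> : M = walk X n t + D%:R by rewrite -IHn; ring.
case: (pt n) => ->; rewrite ?eqxx ?m1_neq1.
  case: D {IHn} => [|D] /=; first by rewrite addr0 max_r; lra.
  by rewrite max_l -natr1; [ring | have := ler0n R D; lra].
by rewrite max_l -?natr1; [ring | have := ler0n R D; lra].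
Qed.

(** By descending induction on [n] from [walk_max_drawdown] at [N]. *)
Lemma walk_max_sub N t n : proper_steps t -> (n <= N)%N ->
  walk_max X N t - walk X n t =
  (maxn (drawdown (take n (sign_path N t)))
        (lindley 0 (drop n (sign_path N t))))%:R.
Proof.
move=> pt nN; have [m mE] : exists m, (n + m = N)%N by exists (N - n)%N; lia.
elim: m n nN mE => [|m IHm] n nN mE.
  rewrite addn0 in mE; rewrite mE drop_oversize ?size_sign_path //= maxn0.
  exact: walk_max_drawdown.
have ltnN : (n < N)%N by lia.
have := IHm n.+1 ltnN; rewrite addSnnS => /(_ mE).
rewrite (drop_sign_path t ltnN) take_sign_pathS // drawdown_rcons walkS.
set D := drawdown _; set M := walk_max _ _ _; set L := lindley _ _.
case: (pt n) => -> /=; rewrite ?eqxx ?m1_neq1 /= -/L => h.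
  have -> : M - walk X n t = (maxn D.-1 L).+1%:R by rewrite -natr1 -h; ring.
  by congr (_%:R); lia.
have -> : M - walk X n t = (maxn D.+1 L)%:R - 1 by rewrite -h; ring.
have -> : maxn D.+1 L = (maxn D L.-1).+1 by lia.
by rewrite -natr1 addrK.
Qed.

Lemma walk_sign_path N t n : proper_steps t -> (n <= N)%N ->
  walk X n t = \sum_(b <- take n (sign_path N t)) (if b then 1 else -1).
Proof.
move=> pt; elim: n => [|n IHn] nN; first by rewrite walk0 take0 big_nil.
rewrite walkS take_sign_pathS // -cats1 big_cat big_seq1 -IHn; last exact: ltnW.
by case: (pt n) => ->; rewrite ?eqxx ?m1_neq1.
Qed.

Variable p : R.
Hypothesis hp : 0 < p < 1.
Hypothesis hX : bernoulli_steps X p.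

Lemma prob_up k : P (X k @^-1` [set 1]) = p%:E.
Proof.
have [_ idX <- _] := hX; have := idX k 0%N [set 1] (measurable_set1 _).
by [].
Qed.

Lemma prob_down k : P (X k @^-1` [set -1]) = (1 - p)%:E.
Proof.
have [_ idX _ <-] := hX; have := idX k 0%N [set -1] (measurable_set1 _).
by [].
Qed.

Lemma measurable_step k (A : set R) : measurable A -> measurable (X k @^-1` A).
Proof.
move=> mA; rewrite -[X in measurable X]setTI.
exact: (measurable_funPT (X k)).
Qed.

Lemma ae_proper_steps : {ae P, forall t, proper_steps t}.
Proof.
have -> : {ae P, forall t, proper_steps t} =
    P.-negligible (\bigcup_k ~` (X k @^-1` [set 1] `|` X k @^-1` [set -1])).
  congr (P.-negligible _); apply/seteqP; split => t /=.
    by move=> /existsNP[k nk]; exists k.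
  by move=> [k _ nk] h; apply: nk; exact: h.
apply: negligible_bigcup => k.
have m1 : measurable (X k @^-1` [set 1]) by apply: measurable_step.
have m2 : measurable (X k @^-1` [set -1]) by apply: measurable_step.
apply/negligibleP; first by apply: measurableC; apply: measurableU.
have PU : P (X k @^-1` [set 1] `|` X k @^-1` [set -1]) = 1%E.
  apply: etrans (measureU P m1 m2 _) _.
    by apply/seteqP; split => t //= [-> /eqP]; rewrite eq_sym m1_neq1.
  rewrite [X in (X + _)%E](prob_up k) [X in (_ + X)%E](prob_down k).
  by apply: etrans (esym (EFinD _ _)) _; rewrite addrC subrK.
rewrite [LHS](probability_setC P); last exact: measurableU.
by rewrite [X in (_ - X)%E]PU subee.
Qed.

Lemma prob_sign k (b : bool) :
  P (X k @^-1` (if b then [set 1] else ~` [set 1])) =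
  (if b then p else 1 - p)%:E.
Proof.
case: b; first exact: prob_up.
rewrite -preimage_setC; apply: etrans (probability_setC P _) _.
  exact: measurable_step.
by rewrite [X in (_ - X)%E](prob_up k) EFinB.
Qed.

Lemma sign_pathP N t e : size e = N ->
  sign_path N t = e <-> forall k, (k < N)%N -> (X k t == 1) = nth false e k.
Proof.
move=> eN; split => [<- k kN|h]; first by rewrite nth_mkseq.
apply: (@eq_from_nth _ false) => [|k]; rewrite size_sign_path // => kN.
by rewrite nth_mkseq // h.
Qed.

Definition path_event N e : set T := [set t | sign_path N t = e].

Lemma path_eventE N e : size e = N -> path_event N e =
  \bigcap_(j in [set` [fset j in iota 0 N]%fset])
     (X j @^-1` (if nth false e j then [set 1] else ~` [set 1])).
Proof.
move=> eN; apply/seteqP; split => t.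
  move=> /(sign_pathP _ eN) h k /=; rewrite !inE mem_iota /= add0n => kN.
  by have := h k kN; case: (nth _ _ _) => [/eqP//|/negbT/eqP].
move=> h; apply/(sign_pathP _ eN) => k kN.
have := h k; rewrite /= !inE mem_iota add0n => /(_ kN).
by case: (nth _ _ _) => /= [->|/eqP/negbTE]; rewrite ?eqxx.
Qed.

Lemma measurable_path_event N e : measurable (path_event N e).
Proof.
have [eN|eN] := eqVneq (size e) N; last first.
  rewrite (_ : path_event N e = set0) //; apply/seteqP; split => t //= h.
  by move: eN; rewrite -h size_sign_path eqxx.
rewrite path_eventE //; apply: fin_bigcap_measurable => [|j _].
  exact: finite_fset.
by apply: measurable_step; case: ifP => _ //; apply: measurableC.
Qed.

Lemma prob_path_event N e : size e = N ->
  P (path_event N e) = (path_weight p e)%:E.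
Proof.
move=> eN; rewrite path_eventE //; have [indX _ _ _] := hX.
rewrite (indX _ (fun j => if nth false e j then [set 1] else ~` [set 1]));
  last first.
  by move=> j; case: ifP => // _; apply: measurableC.
rewrite (perm_big (iota 0 N)) /=; last first.
  by apply: uniq_perm; rewrite ?fset_uniq ?iota_uniq // => k; rewrite !inE.
under eq_bigr do rewrite prob_sign.
rewrite prodEFin; congr EFin; rewrite /path_weight.
rewrite -[in RHS](mkseq_nth false e) big_map eN.
by [].
Qed.

Lemma expectation_sign_path N (F : seq bool -> R) :
  ('E_P[fun t => F (sign_path N t)])%E = (path_mean p N F)%:E.
Proof.
rewrite unlock.
have mB e : measurable (path_event N e) := measurable_path_event N e.
rewrite (eq_integral (fun t => \sum_(e <- sign_seqs N)
    (F e)%:E * (\1_(path_event N e) t)%:E)%E); last first.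
  move=> t _.
  rewrite (bigD1_seq (sign_path N t)) ?sign_seqs_uniq //=; last first.
    by rewrite mem_sign_seqs size_sign_path.
  rewrite indicE mem_set // mule1 big1 ?adde0 // => e ne.
  by rewrite indicE memNset ?mule0 // /path_event /= => h; rewrite h eqxx in ne.
rewrite integral_sum //=; last first.
  by move=> e; apply: integrableZl => //; exact: integrable_indic.
rewrite /path_mean -sumEFin big_seq [RHS]big_seq; apply: eq_bigr => e.
rewrite mem_sign_seqs => /eqP eN.
rewrite integralZl //; last exact: integrable_indic.
rewrite integral_indic // setIT [X in (_ * X)%E](prob_path_event eN).
by rewrite -EFinM mulrC.
Qed.

(** Each sign sequence has positive probability, so its event meets every
    almost sure event. *)
Lemma ae_realized N e (Q : T -> Prop) : size e = N -> {ae P, forall t, Q t} ->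
  exists t, sign_path N t = e /\ Q t.
Proof.
move=> eN aeQ; apply: contrapT => noQ.
have : P.-negligible (path_event N e).
  by apply: negligibleS aeQ => t /= te Qt; apply: noQ; exists t.
move=> /(negligibleP _ (measurable_path_event _ _)).
rewrite [X in X = _](prob_path_event eN) => -[] /eqP.
by rewrite gt_eqF // path_weight_gt0.
Qed.

Lemma ae_on_paths N (Q : seq bool -> Prop) :
  {ae P, forall t, Q (sign_path N t)} <-> (forall e, size e = N -> Q e).
Proof.
split => [aeQ e eN|h].
  by have [t [<-]] := ae_realized eN aeQ.
by apply: aeW => t; apply: h; rewrite size_sign_path.
Qed.

(** Each sign sequence is realised by a point with proper steps; the rule takes
    the value of the stopping time there. *)
Lemma stopping_rule_of N tau : stopping_time X N tau ->
  exists2 rho, stopping_rule N rho &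
    forall t, proper_steps t -> tau t = rho (sign_path N t).
Proof.
move=> [tauN ftau].
have walk_eq n t t' : proper_steps t -> proper_steps t' -> (n <= N)%N ->
    take n (sign_path N t) = take n (sign_path N t') ->
    forall k, (k <= n)%N -> walk X k t = walk X k t'.
  move=> pt pt' nN tt' k kn; rewrite !(walk_sign_path (N := N)) //; try lia.
  by rewrite -(take_takel _ kn) tt' take_takel.
have tau_eq n t t' : proper_steps t -> proper_steps t' ->
    take n (sign_path N t) = take n (sign_path N t') ->
    (tau t <= n)%N = (tau t' <= n)%N.
  move=> pt pt' tt'; case: (leqP n N) => nN; last first.
    by have := tauN t; have := tauN t'; lia.
  apply/idP/idP; apply: (natural_filtration_saturated (ftau n));
    exact: walk_eq.
have /choice[w hw] : forall e, exists t,
    size e = N -> sign_path N t = e /\ proper_steps t.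
  move=> e; have [eN|eN] := pselect (size e = N).
    by have [t ht] := ae_realized eN ae_proper_steps; exists t.
  by have [t _] := ae_realized (size_nseq N true) ae_proper_steps; exists t.
exists (fun e => tau (w e)).
  split => [e _|n e e' eN e'N ee']; first exact: tauN.
  have [we pe] := hw e eN; have [we' pe'] := hw e' e'N.
  by apply: tau_eq; rewrite ?we ?we'.
move=> t pt; have [wt pwt] := hw _ (size_sign_path N t).
have same n : (tau t <= n)%N = (tau (w (sign_path N t)) <= n)%N.
  by apply: tau_eq; rewrite ?wt.
by apply/eqP; rewrite eqn_leq same leqnn -same leqnn.
Qed.

Lemma expected_rewardE N (f : 'I_N.+1 -> R) (g : nat -> R) tau rho :
  (forall k, (k <= N)%N -> g k = f (inord k)) ->
  stopping_time X N tau -> stopping_rule N rho ->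
  (forall t, proper_steps t -> tau t = rho (sign_path N t)) ->
  expected_reward X f tau = (path_mean p N (payoff g rho))%:E.
Proof.
move=> gf [tauN ftau] [rhoN _] tau_rho.
rewrite -expectation_sign_path /expected_reward.
rewrite unlock; apply: ae_eq_integral => //.
- apply/measurable_EFinP.
  apply: (@measurable_fun_select _ _ _ tau
    (fun n t => eval_at f (walk_max X N t - walk X n t))).
    have mle n : measurable [set t | (tau t <= n)%N].
      exact: natural_filtration_measurable (ftau n).
    case=> [|n].
      rewrite (_ : [set t | tau t = 0%N] = [set t | (tau t <= 0)%N]) //.
      by apply/seteqP; split => t /=; lia.
    rewrite (_ : [set t | tau t = n.+1] =
        [set t | (tau t <= n.+1)%N] `\` [set t | (tau t <= n)%N]).
      exact: measurableD.
    by apply/seteqP; split => t /=; lia.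
  move=> n; apply: measurable_eval_at; apply: measurable_funB.
    exact: measurable_walk_max.
  exact: measurable_walk.
- apply/measurable_EFinP => _ B mB; rewrite setTI.
  rewrite (_ : _ @^-1` B = \big[setU/set0]_(e <- sign_seqs N |
      payoff g rho e \in B) path_event N e).
    by apply: bigsetU_measurable => e _; exact: measurable_path_event.
  apply/seteqP; split => t.
    move=> /= h; rewrite -bigcup_seq_cond; exists (sign_path N t) => //=.
    by rewrite mem_sign_seqs size_sign_path eqxx /= mem_set.
  rewrite -bigcup_seq_cond => -[e /= /andP[_ /set_mem h] te].
  by rewrite (_ : sign_path N t = e).
apply: filterS ae_proper_steps => t pt _; congr EFin.
have := walk_max_sub pt (tauN t); rewrite tau_rho // => ->.
rewrite /eval_at natrK /payoff gf // geq_max.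
have := leq_drawdown (take (rho (sign_path N t)) (sign_path N t)).
have := leq_lindley (drop (rho (sign_path N t)) (sign_path N t)).
have := rhoN _ (size_sign_path N t).
by rewrite size_take size_drop size_sign_path; case: ltnP; lia.
Qed.

End walk_transfer.

(** * Optimality *)

Section optimality.
Context {d : measure_display} {T : measurableType d} {R : realType}.
Context {P : probability T R}.
Variables (X : nat -> {RV P >-> R}) (p : R).
Hypothesis hp : 0 < p < 1.
Hypothesis hX : bernoulli_steps X p.

Lemma stopping_time_cst N n : (n <= N)%N -> stopping_time X N (fun=> n).
Proof.
move=> nN; split => // k; rewrite /natural_filtration /g_sigma_preimage.
have [nk|nk] := leqP n k.
  rewrite (_ : [set t | _] = setT).
    exact: (@measurableT _ (g_sigma_algebraType _)).
  by apply/seteqP; split => t //= _; rewrite nk.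
rewrite (_ : [set t | _] = set0).
  exact: (@measurable0 _ (g_sigma_algebraType _)).
by apply/seteqP; split => t //=; rewrite leqNgt nk.
Qed.

Lemma stopping_rule_cst N n : (n <= N)%N -> stopping_rule N (fun=> n).
Proof. by []. Qed.

(** [V] is the value of the problem on sign sequences, [Q] describes the rules
    that attain it and the constant rule [n0] is one of them. *)
Lemma optimalP N (f : 'I_N.+1 -> R) (g : nat -> R) V n0
    (Q : seq bool -> nat -> Prop) :
  (forall k, (k <= N)%N -> g k = f (inord k)) ->
  (forall rho, stopping_rule N rho -> path_mean p N (payoff g rho) <= V /\
    (path_mean p N (payoff g rho) = V <->
     forall e, size e = N -> Q e (rho e))) ->
  (n0 <= N)%N -> (forall e, size e = N -> Q e n0) ->
  forall tau, stopping_time X N tau ->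
    optimal X f tau <-> {ae P, forall t, Q (sign_path X N t) (tau t)}.
Proof.
move=> gf hV n0N Qn0 tau stau.
have val_eq : optimal_value X f = V%:E.
  apply/le_anti/andP; split.
    apply: ge_ereal_sup => _ [sigma ssigma <-].
    have [rho srho sigma_rho] := stopping_rule_of hp hX ssigma.
    rewrite (expected_rewardE hp hX gf ssigma srho sigma_rho) lee_fin.
    exact: (hV rho srho).1.
  apply: ereal_sup_ubound; exists (fun=> n0); first exact: stopping_time_cst.
  rewrite (expected_rewardE hp hX gf (stopping_time_cst n0N)
    (stopping_rule_cst n0N)) //.
  by congr EFin; apply/(hV _ (stopping_rule_cst n0N)).2.
have [rho srho tau_rho] := stopping_rule_of hp hX stau.
have -> : optimal X f tau <-> path_mean p N (payoff g rho) = V.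
  rewrite /optimal val_eq (expected_rewardE hp hX gf stau srho tau_rho).
  by split => [[_ []]|->].
rewrite (hV rho srho).2 -(ae_on_paths hp hX N (fun e => Q e (rho e))).
by split; apply: filterS2 (ae_proper_steps hX) => t pt; rewrite tau_rho.
Qed.

End optimality.

(** * Extending the reward function beyond N *)

Section extension.
Context {R : realType} {N : nat}.
Variables (f : 'I_N.+1 -> R) (c : R).
Hypothesis N0 : (1 <= N)%N.

(** The inequalities on Lindley walks are for functions on all natural numbers.
    The last decrement of [f] is continued beyond [N]; [c] = 0 keeps [f]
    nonincreasing, [c] > 0 makes the extension strictly convex beyond [N]. *)
Definition extension k : R :=
  if (k <= N)%N then f (inord k)
  else f (inord N) - (k - N)%:R * (f (inord N.-1) - f (inord N))
       + c * (k - N)%:R ^+ 2.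

Lemma extensionE k : (k <= N)%N -> extension k = f (inord k).
Proof. by rewrite /extension => ->. Qed.

Lemma extension_past k : (N <= k)%N -> extension k =
  f (inord N) - (k - N)%:R * (f (inord N.-1) - f (inord N))
  + c * (k - N)%:R ^+ 2.
Proof.
rewrite leq_eqVlt => /orP[/eqP <-|Nk]; last by rewrite /extension leqNgt Nk.
by rewrite /extension leqnn subnn expr0n mulr0 mul0r subr0 addr0.
Qed.

Lemma extension_diff2 k : (N <= k.+1)%N ->
  extension k - 2 * extension k.+1 + extension k.+2 =
  if k.+1 == N then c else 2 * c.
Proof.
move=> Nk; case: eqP => kN.
  rewrite (extensionE (k := k)) ?(extension_past (k := k.+1))
    ?(extension_past (k := k.+2)); try lia.
  have -> : (k.+2 - N = 1)%N by lia.
  have -> : (k.+1 - N = 0)%N by lia.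
  by have -> : N.-1 = k; [lia | ring].
have Nk' : (N <= k)%N by lia.
rewrite !extension_past; try lia.
have -> : (k.+2 - N = (k - N) + 2)%N by lia.
have -> : (k.+1 - N = (k - N) + 1)%N by lia.
by rewrite !natrD; ring.
Qed.

Lemma extension_convex : 0 <= c -> convex_fct f -> convex_nat extension.
Proof.
move=> c0 cf k; case: (leqP k.+2 N) => kN.
  by rewrite !extensionE; [apply: cf | lia..].
by rewrite extension_diff2 //; case: eqP => _; lra.
Qed.

Lemma extension_strictly_convex :
  0 < c -> strictly_convex_fct f -> strictly_convex_nat extension.
Proof.
move=> c0 cf k; case: (leqP k.+2 N) => kN.
  by rewrite !extensionE; [apply: cf | lia..].
by rewrite extension_diff2 //; case: eqP => _; lra.
Qed.

Lemma extension_decrement k : c = 0 -> exists2 j, (j < N)%N &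
  extension k - extension k.+1 = f (inord j) - f (inord j.+1).
Proof.
move=> c0; case: (ltnP k N) => kN.
  by exists k; rewrite ?extensionE //; lia.
exists N.-1; first by lia.
rewrite !extension_past; try lia.
have -> : (k.+1 - N = (k - N) + 1)%N by lia.
by rewrite prednK // c0 natrD; ring.
Qed.

Lemma extension_antitone :
  c = 0 -> nonincreasing_fct f -> antitone extension.
Proof.
move=> c0 nf k; rewrite -subr_ge0.
have [j jN ->] := extension_decrement k c0.
by rewrite subr_ge0; apply: nf; rewrite !inordK //; lia.
Qed.

Lemma extension_decreasing :
  c = 0 -> strictly_decreasing_fct f -> forall k, extension k.+1 < extension k.
Proof.
move=> c0 df k; rewrite -subr_gt0.
have [j jN ->] := extension_decrement k c0.
by rewrite subr_gt0; apply: df; rewrite !inordK //; lia.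
Qed.

Lemma extension_nonconstant : c = 0 -> nonincreasing_fct f -> convex_fct f ->
  ~ constant_fct f -> extension 1 < extension 0.
Proof.
move=> c0 nf cf ncf; have nE := extension_antitone c0 nf.
have cE : convex_nat extension by apply: extension_convex; rewrite ?c0.
rewrite lt_neqAle nE andbT; apply/eqP => E01; apply: ncf.
exists (extension 0) => i; rewrite -(inord_val i) -extensionE -1?ltnS //.
elim: (i : nat) => // k IHk; apply/le_anti/andP; split.
  by rewrite -IHk.
have := convex_decrements 1 cE (leq0n k); rewrite add0n addn1 IHk E01; lra.
Qed.

End extension.

Theorem theorem1p2 (d : measure_display) (T : measurableType d) (R : realType)
    (P : probability T R) (N : nat) (p : R) (X : nat -> {RV P >-> R})
    (f : 'I_N.+1 -> R) (hN : (1 <= N)%N) (hp : 0 < p < 1)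
    (hX : bernoulli_steps X p)
    (hf_noninc : nonincreasing_fct f) (hf_convex : convex_fct f) :
  [/\ p < 1 / 2 -> ~ constant_fct f -> unique_optimal X f (fun=> 0%N),
      1 / 2 < p -> strictly_decreasing_fct f -> unique_optimal X f (fun=> N) &
      p = 1 / 2 -> strictly_convex_fct f ->
        forall tau : T -> nat, stopping_time X N tau ->
          (optimal X f tau <->
           {ae P, forall t,
              walk X (tau t) t = walk_max X (tau t) t \/ tau t = N})].
Proof.
have unique n0 : (n0 <= N)%N -> (forall tau, stopping_time X N tau ->
    optimal X f tau <-> {ae P, forall t, tau t = n0}) ->
    unique_optimal X f (fun=> n0).
  move=> n0N h; split.
    by apply/h; [exact: stopping_time_cst | exact: aeW].
  by move=> tau otau; apply/h => //; case: otau.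
split => [p2 ncf|p2 df|p2 scf].
- apply: unique => // tau stau.
  apply: (@optimalP _ _ _ _ _ _ hp hX _ _ (extension f 0) _ 0%N
    (fun _ n => n = 0%N)) => //.
    exact: extensionE.
  apply: stop_at_once_optimal => //; first exact: extension_convex.
    exact: extension_antitone.
  exact: extension_nonconstant.
- apply: unique => // tau stau.
  apply: (@optimalP _ _ _ _ _ _ hp hX _ _ (extension f 0) _ N
    (fun _ n => n = N)) => //.
    exact: extensionE.
  apply: never_stop_optimal => //; first exact: extension_convex.
  exact: extension_decreasing.
move=> tau stau; have [tauN _] := stau.
rewrite (@optimalP _ _ _ _ _ _ hp hX _ _ (extension f 1) _ 0%N
  (fun e n => drawdown (take n e) = 0%N \/ n = N)) //; first last.
- by move=> e _; left; rewrite take0.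
- by rewrite p2; apply: symmetric_optimal; apply: extension_strictly_convex.
- exact: extensionE.
have atmax t : proper_steps X t ->
    walk X (tau t) t = walk_max X (tau t) t <->
    drawdown (take (tau t) (sign_path X N t)) = 0%N.
  move=> pt; have := walk_max_drawdown pt (tauN t); split => [e|d0].
    by move: H; rewrite e subrr => /esym/eqP; rewrite pnatr_eq0 => /eqP.
  by apply/esym/eqP; rewrite -subr_eq0 H d0.
by split; apply: filterS2 (ae_proper_steps hX) => t pt; rewrite atmax.
Qed.
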